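(* Let $X$ be a subset of $\mathbb{N}\setminus\{0\}$. Then $Coe(X)$ is a Coe-semigroup if and only if $X$ contains at least one odd element.
   Context: $\mathbb{N}=\{0,1,2,\ldots\}$. A submonoid of $(\mathbb{N},+)$ is a subset of $\mathbb{N}$ containing $0$ and closed under addition; it is a numerical semigroup if its complement in $\mathbb{N}$ is finite. A numerical semigroup $S$ is a Coe-semigroup if $\{x-1,x+1\}\subseteq S$ for every odd $x\in S$. A Coe-monoid is a submonoid of $(\mathbb{N},+)$ that can be expressed as an intersection of a (finite or infinite) family of Coe-semigroups. For $X\subseteq\mathbb{N}$, $Coe(X)$ denotes the intersection of all Coe-monoids containing $X$, i.e. the smallest Coe-monoid containing $X$. *)

(* Defs.v *)
From mathcomp Require Import all_boot.
From mathcomp Require Import all_classical.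

Set Implicit Arguments.
Unset Strict Implicit.
Unset Printing Implicit Defensive.

Local Open Scope classical_set_scope.

Definition submonoid (S : set nat) : Prop :=
  S 0 /\ forall x y : nat, S x -> S y -> S (x + y).

Definition numerical_semigroup (S : set nat) : Prop :=
  submonoid S /\ finite_set (~` S).

(* An odd [x] is positive, so the truncated subtraction [x - 1] is exact. *)
Definition coe_semigroup (S : set nat) : Prop :=
  numerical_semigroup S /\
  forall x : nat, S x -> odd x -> [set x - 1; x + 1] `<=` S.

(* The family [F] may be finite or infinite.  The empty family is allowed; its
   intersection is [setT], which is itself a Coe-semigroup. *)
Definition coe_monoid (M : set nat) : Prop :=
  submonoid M /\
  exists F : set (set nat), F `<=` coe_semigroup /\ M = \bigcap_(S in F) S.

Definition Coe (X : set nat) : set nat :=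
  \bigcap_(M in [set M | coe_monoid M /\ X `<=` M]) M.

(* Main.v *)
(** If [x] is an odd element of [Coe X], then so is the consecutive [x + 1], and a
submonoid containing two consecutive integers is cofinite.  Conversely, if all
elements of [X] are even, then [X] lies in the Coe-semigroup of the integers
that are even or at least [N], for every [N]; the intersection of these
contains no odd number, so [Coe X] misses infinitely many integers. *)

Require Import Defs.
From mathcomp Require Import all_boot.
From mathcomp Require Import all_classical.

Local Open Scope classical_set_scope.

Lemma submonoid_muln (S : set nat) (n x : nat) :
  submonoid S -> S x -> S (n * x).
Proof.
move=> [S0 SD] Sx; elim: n => [//|n IHn].
by rewrite mulSn; apply: SD.
Qed.

(** Divide: [n = q * x + r] with [r < x]. The bound [x * x <= n] gives [x <= q], so [r <= q], and
    replacing [r] of the [q] copies of [x] by [x + 1] absorbs the remainder. *)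
Lemma submonoid_consecutive (S : set nat) (x n : nat) :
  submonoid S -> 0 < x -> S x -> S (x + 1) -> x * x <= n -> S n.
Proof.
move=> Sm x0 Sx Sx1 len.
have rq : n %% x <= n %/ x.
  by rewrite (leq_trans (ltnW (ltn_pmod n x0)))// leq_divRL.
suff -> : n = (n %/ x - n %% x) * x + n %% x * (x + 1).
  by apply: Sm.2; apply: submonoid_muln.
by rewrite mulnDr muln1 addnA -mulnDl subnK// -divn_eq.
Qed.

Lemma cofinite_geq (S : set nat) (N : nat) :
  (forall n, N <= n -> S n) -> finite_set (~` S).
Proof.
move=> NS; apply: (sub_finite_set _ (finite_II N)) => n /= Sn.
by rewrite ltnNge; apply/negP => /NS.
Qed.

Lemma submonoid_Coe (X : set nat) : submonoid (Coe X).
Proof.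
split=> [M [[[M0 _] _] _] //|x y Xx Xy M XM].
by apply: XM.1.1.2; [exact: Xx|exact: Xy].
Qed.

Lemma sub_Coe (X : set nat) : X `<=` Coe X.
Proof. by move=> x Xx M [_]; apply. Qed.

(** The closure condition passes to intersections, first from Coe-semigroups to Coe-monoids, then to
    [Coe X]. *)
Lemma Coe_odd (X : set nat) (x : nat) :
  Coe X x -> odd x -> [set x - 1; x + 1] `<=` Coe X.
Proof.
move=> Xx ox y xy M XM; have Mx := Xx M XM.
case: XM Mx => -[_ [F [FS ->]]] _ Mx S FSS.
exact: (FS S FSS).2 x (Mx S FSS) ox y xy.
Qed.

Lemma Coe_sub_coe_semigroup (X S : set nat) :
  coe_semigroup S -> X `<=` S -> Coe X `<=` S.
Proof.
move=> cS XS x; apply; split=> //; split; first exact: cS.1.1.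
(* The one-member family shows that [S] is itself a Coe-monoid. *)
by exists [set S]; split; [move=> _ ->|rewrite bigcap_set1].
Qed.

Lemma coe_semigroup_even_or_geq (N : nat) :
  coe_semigroup [set n | ~~ odd n \/ N <= n].
Proof.
split; first split; first split.
- by left.
- move=> x y /= [ex|Nx] [ey|Ny]; last by right; rewrite (leq_trans Nx) ?leq_addr.
  + by left; rewrite oddD (negbTE ex).
  + by right; rewrite (leq_trans Ny) ?leq_addl.
  + by right; rewrite (leq_trans Nx) ?leq_addr.
- by apply: (cofinite_geq _ N) => n; right.
(* Both neighbours of an odd number are even. *)
- by case=> // n _ on y /= [] ->; left; rewrite ?subn1 ?addn1 /= ?negbK.
Qed.

Lemma Coe_even (X : set nat) (n : nat) :
  (forall x, X x -> ~~ odd x) -> Coe X n -> ~~ odd n.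
Proof.
move=> eX Xn.
(* With threshold [n.+1], [n] itself can belong to the set only by being even. *)
have XS : X `<=` [set m | ~~ odd m \/ n.+1 <= m] by move=> x /eX; left.
have := Coe_sub_coe_semigroup _ _ (coe_semigroup_even_or_geq n.+1) XS n Xn.
by case=> //; rewrite ltnn.
Qed.

Lemma infinite_odd : infinite_set [set n | odd n].
Proof.
move=> fin; apply: infinite_nat.
(* This injection has only odd values, so finitely many odd numbers would make [nat] finite. *)
have inj : {in (fun n => n.*2.+1) @^-1` [set n | odd n] &,
             injective (fun n => n.*2.+1)}.
  by move=> m n _ _ [] /double_inj.
apply: sub_finite_set (finite_preimage inj fin) => n _ /=.
by rewrite odd_double.
Qed.

Theorem corollary37 (X : set nat) (hX : X `<=` setT `\ 0) :
  coe_semigroup (Coe X) <-> exists x : nat, X x /\ odd x.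
Proof.
split=> [[[_ fin] _]|[x [Xx ox]]].
- apply: contrapT => noodd; apply: infinite_odd.
  apply: sub_finite_set fin => n /= on Xn.
  apply/negP: on; apply: Coe_even Xn => x Xx.
  by apply/negP => ox; apply: noodd; exists x.
- have Cx := sub_Coe _ _ Xx.
  split; last exact: Coe_odd.
  split; first exact: submonoid_Coe.
  apply: (cofinite_geq _ (x * x)) => n.
  apply: submonoid_consecutive => //; first exact: submonoid_Coe.
  + exact: odd_gt0.
  + by apply: (Coe_odd _ _ Cx ox); right.
Qed.
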